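(* Let $r \in (0,1)$ be such that $\{(rz_1, rz_2, rz_3) : (z_1,z_2,z_3) \in \overline{\mathbb{D}}^3\} \subset \mathbb{E}$, where $\mathbb{E}$ is the tetrablock. Let $\lambda_1, \lambda_2, \lambda_3 \in \mathbb{C}$ satisfy $0 < |\lambda_j| < r$ for $j = 1,2,3$ and $|\lambda_1| \neq |\lambda_2|$. Let $$T_j = \begin{bmatrix} 0 & \lambda_j \\ 0 & 0 \end{bmatrix}, \qquad j = 1,2,3,$$ acting on $\mathbb{C}^2$. Then the commuting triple $(T_1, T_2, T_3)$ is a tetrablock contraction, and its fundamental operators $F_1$ and $F_2$ do not commute, i.e. $F_1F_2 \neq F_2F_1$.
   Context: $\mathbb{D}$ is the open unit disk in $\mathbb{C}$ and $\overline{\mathbb{D}}$ its closure. The tetrablock is $$\mathbb{E} = \left\{ (a_{11}, a_{22}, \det A) \in \mathbb{C}^3 : A = \begin{pmatrix} a_{11} & a_{12} \\ a_{21} & a_{22} \end{pmatrix} \in M_2(\mathbb{C}),\ \|A\|_{op} < 1 \right\}.$$ The closed tetrablock $\overline{\mathbb{E}}$ is the set obtained by replacing $\|A\|_{op} < 1$ with $\|A\|_{op} \le 1$; it is compact and polynomially convex. For a compact set $K \subset \mathbb{C}^d$, $\mathcal{R}(K)$ denotes the algebra of rational functions in $d$ variables with poles off $K$, with norm $\|f\|_{\infty,K} = \sup\{|f(\boldsymbol{z})| : \boldsymbol{z} \in K\}$. $K$ is a spectral set for a $d$-tuple $\boldsymbol{T} = (T_1,\dots,T_d)$ of commuting bounded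 operators on a Hilbert space if the Taylor joint spectrum satisfies $\sigma(\boldsymbol{T}) \subseteq K$ (for commuting matrices, $\sigma(\boldsymbol{T})$ is the set of joint eigenvalues) and $\|f(\boldsymbol{T})\| \le \|f\|_{\infty,K}$ for every $f \in \mathcal{R}(K)$. A tetrablock contraction is a commuting triple $(T_1,T_2,T_3)$ of bounded operators on a Hilbert space having $\overline{\mathbb{E}}$ as a spectral set. For a tetrablock contraction $(T_1,T_2,T_3)$ on a Hilbert space $\mathcal{H}$, put $D_{T_3} = (I - T_3^*T_3)^{1/2}$ and $\mathcal{D}_{T_3} = \overline{\operatorname{Ran}}\, D_{T_3}$. It is known that there exist unique bounded linear operators $F_1, F_2$ on $\mathcal{D}_{T_3}$ such that $$T_1 - T_2^*T_3 = D_{T_3}F_1D_{T_3} \quad \text{and} \quad T_2 - T_1^*T_3 = D_{T_3}F_2D_{T_3}.$$ These are called the fundamental operators of $(T_1,T_2,T_3)$. *)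

(* Defs.v *)
From HB Require Import structures.
From mathcomp Require Import all_boot all_order all_algebra.
From mathcomp Require Import sesquilinear complex.
From mathcomp Require Import boolp classical_sets reals ereal.
(* Not imported: the notations of mpoly clash with those of the classical
   library. *)
From mathcomp Require mpoly.

Set Implicit Arguments.
Unset Strict Implicit.
Unset Printing Implicit Defensive.

Import Order.TTheory GRing.Theory Num.Theory.

Local Open Scope classical_set_scope.
Local Open Scope ring_scope.
Local Open Scope complex_scope.
Local Open Scope sesquilinear_scope.

Section Operators.
Variable R : realType.
Local Notation C := R[i].

(* Matrices act on column vectors, i.e. on the Hilbert space C^n with its
   Euclidean norm. *)
Definition vnorm n (x : 'cV[C]_n) : R :=
  Num.sqrt (\sum_(i < n) Normc.normc (x i 0) ^+ 2).

Definition opnorm m n (A : 'M[C]_(m, n)) : R :=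
  sup [set vnorm (A *m x) | x in [set x | vnorm x <= 1]].

(* The order of C = R[i] is partial: 0 <= z means that z is real and
   nonnegative, so psd implies self-adjoint. *)
Definition psd n (A : 'M[C]_n) : Prop :=
  forall x : 'cV[C]_n, 0 <= (x^t* *m A *m x) 0 0.

(* A positive semidefinite matrix has exactly one positive semidefinite square
   root; the value is 0 if there is none. *)
Definition psd_sqrt n (A : 'M[C]_n) : 'M[C]_n :=
  xget 0 [set S | psd S /\ S *m S = A].

End Operators.

Section SpectralSets.
Variables (R : realType) (d n : nat).
Local Notation C := R[i].
Implicit Types (K : set 'rV[C]_d) (T : 'I_d -> 'M[C]_n.+1).
Implicit Types p q : mpoly.mpoly d C.

Definition joint_spectrum T : set 'rV[C]_d :=
  [set z | exists2 v : 'cV[C]_n.+1, v != 0 & forall i, T i *m v = z 0 i *: v].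

Definition poly_at p (z : 'rV[C]_d) : C := mpoly.meval (fun i => z 0 i) p.

Definition poly_tuple p T : 'M[C]_n.+1 := mpoly.mmap (@scalar_mx C n.+1) T p.

(* A rational function with poles off K is a quotient p / q of polynomials with
   q vanishing nowhere on K. If T is commuting with joint spectrum in K then
   q(T) is invertible. *)
Definition poles_off q K : Prop := forall z, K z -> poly_at q z != 0.

Definition rat_tuple p q T : 'M[C]_n.+1 :=
  poly_tuple p T *m invmx (poly_tuple q T).

(* Extended-real supremum; it is finite when K is compact and nonempty. *)
Definition rat_supnorm p q K : \bar R :=
  ereal_sup [set (Normc.normc (poly_at p z / poly_at q z))%:E | z in K].

Definition spectral_set K T : Prop :=
  joint_spectrum T `<=` K /\
  forall p q, poles_off q K ->
    ((opnorm (rat_tuple p q T))%:E <= rat_supnorm p q K)%E.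

End SpectralSets.

Section Tetrablock.
Variable R : realType.
Local Notation C := R[i].

Definition tetrablock_point (A : 'M[C]_2) : 'rV[C]_3 :=
  \row_(i < 3) [:: A 0 0; A 1 1; \det A]`_i.

Definition tetrablock : set 'rV[C]_3 :=
  [set tetrablock_point A | A in [set A | opnorm A < 1]].

Definition closed_tetrablock : set 'rV[C]_3 :=
  [set tetrablock_point A | A in [set A | opnorm A <= 1]].

Definition closed_polydisc : set 'rV[C]_3 :=
  [set z | forall i, `|z 0 i| <= 1].

Variable n : nat.
Implicit Types (T : 'I_3 -> 'M[C]_n.+1) (S : 'M[C]_n.+1).

Definition tetrablock_contraction T : Prop :=
  (forall i j, T i *m T j = T j *m T i) /\ spectral_set closed_tetrablock T.

Definition defect S : 'M[C]_n.+1 := psd_sqrt (1%:M - S^t* *m S).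

(* The range is closed, being finite-dimensional. *)
Definition defect_space S : {vspace 'cV[C]_n.+1} := limg (linfun (mulmx (defect S))).

(* T 0, T 1, T 2 are T_1, T_2, T_3. As D h lies in the defect space, vsproj
   only changes its type there. *)
Definition fundamental_operators T (F1 F2 : 'End(subvs_of (defect_space (T 2)))) : Prop :=
  let D := defect (T 2) in
  let V := defect_space (T 2) in
  (forall h : 'cV[C]_n.+1,
     (T 0 - (T 1)^t* *m T 2) *m h = D *m vsval (F1 (vsproj V (D *m h)))) /\
  (forall h : 'cV[C]_n.+1,
     (T 1 - (T 0)^t* *m T 2) *m h = D *m vsval (F2 (vsproj V (D *m h)))).

End Tetrablock.

Arguments fundamental_operators {R n} T F1 F2.
Arguments tetrablock R : clear implicits.
Arguments closed_tetrablock R : clear implicits.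
Arguments closed_polydisc R : clear implicits.

(* Main.v *)
Require Import Defs.
From mathcomp Require Import all_boot all_order all_algebra.
From mathcomp Require Import cyclic separable cyclotomic sesquilinear complex.
From mathcomp Require Import boolp classical_sets reals ereal.
From mathcomp Require Import ring.
From mathcomp Require mpoly.

Set Implicit Arguments.
Unset Strict Implicit.
Unset Printing Implicit Defensive.

Import Order.TTheory GRing.Theory Num.Theory.

Local Open Scope classical_set_scope.
Local Open Scope ring_scope.

(** Write N for the nilpotent Jordan block on C^2, so that T_j = lam_j N.

    The triple is a tetrablock contraction because the closed analytic disc
    t |-> t lam lies in r times the closed polydisc, hence in the closed
    tetrablock, and because N is a contraction: for f = p / q with poles off the
    closed tetrablock and g(t) = f(t lam), one has f(T) = g(N), and the bound
    |g(N)| <= sup |g| over the closed unit disc is von Neumann's inequality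
    ([spectral_set_jordan_block]).  It is obtained without integrals or power
    series.  For a polynomial G, the vector G(N)(y, x) consists of the two
    lowest coefficients of G times the polynomial x + y t, so Parseval's identity
    at the roots of unity of an order exceeding the degree gives
    |G(N)| <= sup |G| over the unit circle ([low_coefs_contraction]).  A
    rational g = P / Q is reduced to a polynomial by multiplying each factor
    t - z of Q, where |z| > 1, up to 1 - (t / z)^m for a large m: this produces
    a polynomial H with Q H = 1 modulo t^2 and |Q H| bounded on the circle by a
    number as close to 1 as desired ([poly_inverse_mod_X2]).  Then g(N) = (P H)(N)
    because N^2 = 0, while |P H| = |g| |Q H| is almost bounded by sup |g|.

    Since |lam_3| < 1, the defect operator D of T_3 is invertible, its square
    being diag(1, 1 - |lam_3|^2).  The defect space is therefore everything and
    the fundamental operators are D^-1 X D^-1 and D^-1 Y D^-1, where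
    X = T_1 - T_2^* T_3 and Y = T_2 - T_1^* T_3.  They commute only if
    X D^-2 Y = Y D^-2 X ([compressed_commute]), which involves D only through
    its known square.  The upper right entries of these two products are
    proportional to |lam_1|^2 and |lam_2|^2 with the same nonzero factor
    ([commuting_fundamental_entry]), which contradicts |lam_1| <> |lam_2|. *)

(** * Parseval's identity at roots of unity *)

Section Fourier.
Variable C : numClosedFieldType.

Lemma primitive_root_exists n : (n > 0)%N ->
  exists w : C, n.-primitive_root w.
Proof.
move=> n_gt0; pose p : {poly C} := 'X^n - 1.
have [r Dp] := closed_field_poly_normal p.
rewrite (monicP _) ?monicXnsubC // scale1r in Dp.
have rn1 : all n.-unity_root r by apply/allP=> z; rewrite -root_prod_XsubC -Dp.
have sz_r : (n < (size r).+1)%N.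
  by rewrite -(size_prod_XsubC r id) -Dp size_XnsubC.
have [|z] := hasP (has_prim_root n_gt0 rn1 _ sz_r); last by exists z.
by rewrite -separable_prod_XsubC -Dp separable_Xn_sub_1 // pnatr_eq0 -lt0n.
Qed.

Lemma norm_prim_root n (w : C) : n.-primitive_root w -> `|w| = 1.
Proof.
move=> w_prim; apply/eqP.
rewrite -(@pexpr_eq1 _ _ n) ?(prim_order_gt0 w_prim) ?normr_ge0 //.
by rewrite -normrX prim_expr_order // normr1.
Qed.

(** Off the diagonal this is a full geometric sum of ratio
    w ^+ i / w ^+ j <> 1, an n-th root of unity. *)
Lemma prim_root_orthogonality n (w : C) (i j : 'I_n) :
  n.-primitive_root w ->
  \sum_(k < n) w ^+ (k * i) * (w ^+ (k * j))^* = (i == j)%:R *+ n.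
Proof.
move=> w_prim; have w_norm := norm_prim_root w_prim.
have w_neq0 : w != 0 by rewrite -normr_eq0 w_norm oner_neq0.
have wC m : (w ^+ m)^* = (w ^+ m)^-1 by rewrite invC_norm normrX w_norm !expr1n invr1 mul1r.
pose x := w ^+ i / w ^+ j.
have sum_geom : \sum_(k < n) w ^+ (k * i) * (w ^+ (k * j))^* = \sum_(k < n) x ^+ k.
  apply: eq_bigr => k _; rewrite wC /x expr_div_n -!exprM.
  by rewrite (mulnC i) (mulnC j).
rewrite {}sum_geom; have [eq_ij|neq_ij] := eqVneq i j.
  rewrite /x eq_ij divff ?expf_neq0 //.
  by under eq_bigr do rewrite expr1n; rewrite sumr_const card_ord.
have x_neq1 : x - 1 != 0.
  rewrite subr_eq0 /x; apply: contra_neq neq_ij => x1; apply/eqP.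
  have: w ^+ i == w ^+ j.
    by rewrite -[X in X == _](divfK (expf_neq0 j w_neq0)) x1 mul1r.
  by rewrite (eq_prim_root_expr w_prim) !modn_small.
apply: (mulfI x_neq1); rewrite mul0rn mulr0 -subrX1 /x expr_div_n.
by rewrite -!exprM !(mulnC _ n) !exprM (prim_expr_order w_prim) !expr1n divr1 subrr.
Qed.

Lemma discrete_parseval n (w : C) (p : {poly C}) :
  n.-primitive_root w -> (size p <= n)%N ->
  \sum_(k < n) `|p.[w ^+ k]| ^+ 2 = (\sum_(i < n) `|p`_i| ^+ 2) *+ n.
Proof.
move=> w_prim szp.
transitivity (\sum_(k < n) \sum_(i < n) \sum_(j < n)
    (p`_i * (p`_j)^* * (w ^+ (k * i) * (w ^+ (k * j))^*))).
  apply: eq_bigr => k _; rewrite normCK (horner_coef_wide _ szp).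
  rewrite rmorph_sum mulr_suml; apply: eq_bigr => i _.
  rewrite mulr_sumr; apply: eq_bigr => j _.
  by rewrite rmorphM /= -!exprM mulrACA.
rewrite exchange_big -sumrMnl; apply: eq_bigr => i _ /=.
rewrite exchange_big (bigD1 i) //= [X in _ + X]big1 => [|j neq_ji].
  by rewrite addr0 -mulr_sumr prim_root_orthogonality // eqxx mulrnAr mulr1 normCK.
by rewrite -mulr_sumr prim_root_orthogonality // eq_sym (negPf neq_ji) mul0rn mulr0.
Qed.

(** The left-hand side is the part carried by the coefficients 0 and 1 of
    p = G * (x + y t).  By Parseval, the sum over all coefficients is the mean of
    |p|^2 over sufficiently many roots of unity, where |p| <= M |x + y t|; the
    mean of |x + y t|^2 is |x|^2 + |y|^2. *)
Lemma low_coefs_contraction (G : {poly C}) (M x y : C) : 0 <= M ->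
  (forall t, `|t| = 1 -> `|G.[t]| <= M) ->
  `|G`_0 * x| ^+ 2 + `|G`_0 * y + G`_1 * x| ^+ 2
    <= M ^+ 2 * (`|x| ^+ 2 + `|y| ^+ 2).
Proof.
move=> M_ge0 leGM; pose u : {poly C} := x%:P + y *: 'X; pose p := G * u.
(* Parseval requires n to bound both size p and size u <= 2. *)
pose n := (maxn (size p) 2); have n_ge2 : (2 <= n)%N by rewrite leq_maxr.
have n_gt0 : (0 < n)%N by apply: leq_trans n_ge2.
have [w w_prim] := primitive_root_exists n_gt0.
have szu : (size u <= n)%N.
  apply: leq_trans n_ge2; rewrite (leq_trans (size_polyD _ _)) // geq_max.
  rewrite (leq_trans (size_polyC_leq1 _)) //=.
  by rewrite (leq_trans (size_scale_leq _ _)) // size_polyX.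
have u0 : u`_0 = x by rewrite coefD coefC coefZ coefX mulr0 addr0.
have u1 : u`_1 = y by rewrite coefD coefC coefZ coefX mulr1 add0r.
have p0 : p`_0 = G`_0 * x by rewrite coefM big_ord1 subn0 u0.
have p1 : p`_1 = G`_0 * y + G`_1 * x.
  by rewrite coefM big_ord_recl big_ord1 /= u0 u1.
have split2 (q : {poly C}) : \sum_(i < n) `|q`_i| ^+ 2 =
    `|q`_0| ^+ 2 + `|q`_1| ^+ 2 + \sum_(2 <= i < n) `|q`_i| ^+ 2.
  rewrite -(big_mkord xpredT (fun i => `|q`_i| ^+ 2)).
  by rewrite big_ltn // big_ltn // addrA.
have sum_u : \sum_(i < n) `|u`_i| ^+ 2 = `|x| ^+ 2 + `|y| ^+ 2.
  rewrite split2 u0 u1 big_nat_cond big1 ?addr0 // => i /andP[/andP[i_ge2 _] _].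
  case: i i_ge2 => [|[|i]] // _.
  by rewrite coefD coefC coefZ coefX /= mulr0 addr0 normr0 expr0n.
rewrite -sum_u -p0 -p1.
apply: (@le_trans _ _ (\sum_(i < n) `|p`_i| ^+ 2)).
  by rewrite split2 lerDl sumr_ge0 // => i _; rewrite exprn_ge0.
rewrite -(ler_pMn2r n_gt0) -mulrnAr.
rewrite -(discrete_parseval w_prim szu) -(discrete_parseval w_prim (leq_maxl _ _)).
rewrite mulr_sumr ler_sum // => k _; rewrite /p hornerM normrM exprMn.
rewrite ler_wpM2r ?exprn_ge0 // ler_pXn2r ?nnegrE ?normr_ge0 // leGM //.
by rewrite normrX (norm_prim_root w_prim) expr1n.
Qed.

End Fourier.

Local Open Scope complex_scope.

(** * Multiples close to 1 of a polynomial without zeros in the disc *)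
Section ApproximateInverse.
Variable R : realType.
Local Notation C := R[i].

Lemma normC_normc (z : C) : `|z| = (Normc.normc z)%:C.
Proof. by case: z. Qed.

Lemma invr_expr_small (x e : R) : 1 < x -> 0 < e ->
  exists k, (x ^+ k.+2)^-1 <= e.
Proof.
move=> x_gt1 e_gt0; have d_gt0 : 0 < x - 1 by rewrite subr_gt0.
have bernoulli m : (x - 1) *+ m <= x ^+ m.
  suff: 1 + (x - 1) *+ m <= x ^+ m by apply: le_trans; rewrite lerDr.
  elim: m => [|m IHm]; first by rewrite mulr0n addr0 expr0.
  have xm_ge1 : 1 <= x ^+ m by rewrite exprn_ege1 // ltW.
  rewrite exprS -[X in X * _](subrK 1) mulrDl mul1r mulrS addrCA lerD //.
  by rewrite ler_peMr // ltW.
pose k := Num.bound (e^-1 / (x - 1)); exists k.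
have x_gt0 : 0 < x by apply: lt_trans x_gt1.
rewrite -[leRHS]invrK lef_pV2 ?posrE ?invr_gt0 ?exprn_gt0 //.
apply: le_trans (bernoulli _); rewrite -[leRHS]mulr_natl -ler_pdivrMr //.
apply: ltW; apply: lt_le_trans (archi_boundP _) _; last by rewrite ler_nat ltnW.
by rewrite divr_ge0 // ?invr_ge0 ltW.
Qed.

(** The multiple is 1 - (t / z)^m, with m so large that |z|^-m <= B - 1. *)
Lemma XsubC_inverse_mod_X2 (z : C) (B : R) : 1 < `|z| -> 1 < B ->
  exists H E : {poly C}, ('X - z%:P) * H = 1 + 'X^2 * E /\
    forall t, `|t| = 1 -> `|(('X - z%:P) * H).[t]| <= B%:C.
Proof.
move=> z_gt1 B_gt1; have z_neq0 : z != 0.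
  by rewrite -normr_gt0 (lt_trans _ z_gt1).
have [k k_small] : exists k, (Normc.normc z ^+ k.+2)^-1 <= B - 1.
  by apply: invr_expr_small; rewrite ?subr_gt0 // -ltcR -normC_normc.
exists (- (z ^- k.+2) *: \sum_(i < k.+2) 'X^(k.+1 - i) * (z%:P) ^+ i).
exists (- (z ^- k.+2) *: 'X^k).
have -> : ('X - z%:P) * (- (z ^- k.+2) *: \sum_(i < k.+2) 'X^(k.+1 - i) * (z%:P) ^+ i)
    = 1 + 'X^2 * (- (z ^- k.+2) *: 'X^k).
  rewrite -!scalerAr -exprD add2n -subrXX -rmorphXn /= scalerBr !scaleNr.
  by rewrite opprK addrC -mul_polyC -rmorphM /= mulVf ?expf_neq0.
split=> // t t1; rewrite !hornerE.
rewrite (le_trans (ler_normD _ _)) // normr1 normrM normrM normrN normfV !normrX t1.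
rewrite !expr1n mul1r mulr1 -[B](subrKC 1) rmorphD rmorph1 lerD2l.
by rewrite normC_normc -rmorphXn -fmorphV /= lecR.
Qed.

(** Each of the two factors in the induction step is granted the bound
    sqrt B. *)
Lemma prod_XsubC_inverse_mod_X2 (s : seq C) (B : R) :
  (forall z, z \in s -> 1 < `|z|) -> 1 < B ->
  let Q := \prod_(z <- s) ('X - z%:P) in
  exists H E : {poly C}, Q * H = 1 + 'X^2 * E /\
    forall t, `|t| = 1 -> `|(Q * H).[t]| <= B%:C.
Proof.
elim: s B => [|z s IHs] B s_gt1 B_gt1 /=.
  exists 1, 0; rewrite big_nil mulr1 mulr0 addr0; split=> // t _.
  by rewrite hornerC normr1 lecR ltW.
have sB_gt1 : 1 < Num.sqrt B by rewrite -sqrtr1 ltr_sqrt // (lt_trans _ B_gt1).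
have [H1 [E1 [H1E H1B]]] := XsubC_inverse_mod_X2 (s_gt1 z (mem_head _ _)) sB_gt1.
have [||H2 [E2 [H2E H2B]]] := IHs (Num.sqrt B) => //.
  by move=> y ys; apply: s_gt1; rewrite inE ys orbT.
set Q := \prod_(y <- s) _ in H2E H2B.
exists (H1 * H2), (E1 + E2 + E1 * 'X^2 * E2).
rewrite big_cons -/Q mulrACA; split=> [|t t1].
  by rewrite H1E H2E; ring.
rewrite hornerM normrM -(sqr_sqrtr (ltW (lt_trans ltr01 B_gt1))) expr2.
by rewrite rmorphM ler_pM ?H1B ?H2B.
Qed.

(** For an operator N with N^2 = 0, H(N) is the inverse of Q(N); B close to 1
    makes P H almost as small as P / Q on the circle. *)
Lemma poly_inverse_mod_X2 (Q : {poly C}) (B : R) :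
  (forall t, `|t| <= 1 -> Q.[t] != 0) -> 1 < B ->
  exists H E : {poly C}, Q * H = 1 + 'X^2 * E /\
    forall t, `|t| = 1 -> `|(Q * H).[t]| <= B%:C.
Proof.
move=> Q_neq0 B_gt1; have [s DQ] := closed_field_poly_normal Q.
have lQ_neq0 : lead_coef Q != 0.
  apply: contraNneq (Q_neq0 0 _) => [lQ0|]; last by rewrite normr0.
  by rewrite DQ lQ0 scale0r horner0.
have s_gt1 z : z \in s -> 1 < `|z|.
  move=> zs; rewrite real_ltNge ?normr_real ?real1 //.
  apply/negP => /Q_neq0; rewrite DQ hornerZ mulf_eq0 negb_or => /andP[_].
  by rewrite -/(root _ z) root_prod_XsubC zs.
have [H [E [HE HB]]] := prod_XsubC_inverse_mod_X2 s_gt1 B_gt1.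
exists ((lead_coef Q)^-1 *: H), E.
have -> : Q * ((lead_coef Q)^-1 *: H) = \prod_(z <- s) ('X - z%:P) * H.
  by rewrite {1}DQ -scalerAl -scalerAr scalerA divff // scale1r.
by split.
Qed.

End ApproximateInverse.

(** * Von Neumann's inequality on a disc for the Jordan block *)

(** Since N^2 = 0, horner_mx N factors through polynomials modulo 'X^2. *)
Lemma horner_mx_sqr0 (K : comNzRingType) n (N : 'M[K]_n.+1) (G : {poly K}) :
  N *m N = 0 -> horner_mx N G = (G`_0)%:M + G`_1 *: N.
Proof.
move=> NN0; elim/poly_ind: G => [|p c IHp].
  by rewrite rmorph0 !coef0 scale0r addr0 raddf0.
rewrite rmorphD rmorphM /= horner_mx_X horner_mx_C IHp !coefD !coefMX !coefC /=.
rewrite add0r addr0 addrC; congr (_ + _).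
by rewrite -mulmxE mulmxDl mul_scalar_mx -scalemxAl NN0 scaler0 addr0.
Qed.

Section DiscInSpectralSet.
Variable R : realType.
Local Notation C := R[i].

Lemma vnorm_ge0 n (x : 'cV[C]_n) : 0 <= vnorm x.
Proof. exact: sqrtr_ge0. Qed.

Lemma vnorm_sqr n (x : 'cV[C]_n) : (vnorm x ^+ 2)%:C = \sum_i `|x i 0| ^+ 2.
Proof.
rewrite sqr_sqrtr; last by apply: sumr_ge0 => i _; apply: sqr_ge0.
by rewrite rmorph_sum; apply: eq_bigr => i _; rewrite rmorphXn /= -normC_normc.
Qed.

Lemma opnorm_le m n (A : 'M[C]_(m, n)) (M : R) : 0 <= M ->
  (forall x, vnorm (A *m x) <= M * vnorm x) -> opnorm A <= M.
Proof.
move=> M_ge0 leAM; apply: ge_sup.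
  exists (vnorm (A *m 0)), 0 => //=.
  rewrite -(@ler_pXn2r _ 2) ?nnegrE ?vnorm_ge0 // -lecR vnorm_sqr expr1n rmorph1.
  by rewrite big1 ?ler01 // => i _; rewrite mxE normr0 expr0n.
by move=> _ [x x1 <-]; apply: le_trans (leAM x) _; rewrite ler_piMr.
Qed.

Local Notation N := (delta_mx 0 1 : 'M[C]_2).

Lemma jordan_block_sqr0 : N *m N = 0.
Proof. by rewrite mul_delta_mx_0. Qed.

(** With x = (y, x') the vector G(N) x lists the coefficients 1 and 0 of
    G * (x' + y t), so this is the contraction property of those coefficients. *)
Lemma von_neumann_jordan_block (G : {poly C}) (M : R) : 0 <= M ->
  (forall t, `|t| = 1 -> `|G.[t]| <= M%:C) -> opnorm (horner_mx N G) <= M.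
Proof.
move=> M_ge0 leGM; apply: opnorm_le => // x.
rewrite -(@ler_pXn2r _ 2) ?nnegrE ?mulr_ge0 ?vnorm_ge0 // -lecR exprMn [leRHS]rmorphM /=.
rewrite !vnorm_sqr !big_ord_recl !big_ord0 !addr0 rmorphXn /=.
rewrite (horner_mx_sqr0 G jordan_block_sqr0) mulmxDl -scalemxAl mul_scalar_mx.
rewrite [X in X <= _]addrC [X in _ <= _ * X]addrC.
have lift01 : lift ord0 ord0 = 1 :> 'I_2 by apply: val_inj.
have Nx i : (N *m x) i 0 = (i == 0)%:R * x 1 0.
  rewrite !mxE !big_ord_recl big_ord0 !mxE lift01 /=.
  by rewrite andbF andbT mul0r add0r addr0.
have AxE i : (G`_0 *: x + G`_1 *: (N *m x)) i 0 =
    G`_0 * x i 0 + G`_1 * ((i == 0)%:R * x 1 0).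
  by rewrite mxE [X in X + _]mxE [X in _ + X]mxE Nx.
rewrite !AxE lift01 /= mul0r mulr0 addr0 mul1r.
by apply: low_coefs_contraction; rewrite ?lecR.
Qed.

(** The restriction t |-> p (t lam) of p to the line spanned by lam. *)
Definition line_poly d (lam : 'I_d -> C) (p : mpoly.mpoly d C) : {poly C} :=
  mpoly.mmap polyC (fun i => lam i *: 'X) p.

Lemma horner_line_poly d (lam : 'I_d -> C) p t :
  (line_poly lam p).[t] = poly_at p (\row_i (lam i * t)).
Proof.
rewrite /line_poly /poly_at /mpoly.meval /mpoly.mmap horner_sum.
apply: eq_bigr => m _; rewrite hornerCM horner_prod; congr (_ * _).
by apply: eq_bigr => i _; rewrite !hornerE !mxE.
Qed.

Lemma poly_tuple_line n d (lam : 'I_d -> C) p (A : 'M[C]_n.+1) :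
  poly_tuple p (fun i => lam i *: A) = horner_mx A (line_poly lam p).
Proof.
rewrite /poly_tuple /line_poly /mpoly.mmap rmorph_sum.
apply: eq_bigr => m _; rewrite rmorphM /= horner_mx_C rmorph_prod; congr (_ * _).
by apply: eq_bigr => i _; rewrite rmorphXn /= linearZ /= horner_mx_X.
Qed.

Lemma joint_spectrum_jordan_block d (lam : 'I_d -> C) :
  joint_spectrum (fun i => lam i *: N) `<=` [set 0].
Proof.
move=> z [v v_neq0 vz]; apply/rowP => i; rewrite [RHS]mxE; apply/eqP.
have zz0 : (z 0 i * z 0 i) *: v = 0.
  rewrite -scalerA -vz scalemxAr -vz mulmxA -scalemxAl -scalemxAr jordan_block_sqr0.
  by rewrite !scaler0 mul0mx.
by move/eqP: zz0; rewrite scaler_eq0 (negPf v_neq0) orbF mulf_eq0 orbb.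
Qed.

(** K contains the closed disc spanned by lam, on which von Neumann's inequality
    for N is applied to t |-> (p / q)(t lam). *)
Lemma spectral_set_jordan_block d (K : set 'rV[C]_d) (lam : 'I_d -> C) :
  (forall t, `|t| <= 1 -> K (\row_i (lam i * t))) ->
  spectral_set K (fun i => lam i *: N).
Proof.
move=> discK.
have K0 : K 0.
  have := discK 0; rewrite normr0 ler01 => /(_ isT).
  by congr K; apply/rowP => i; rewrite !mxE mulr0.
split=> [z /joint_spectrum_jordan_block -> //|p q q_off].
have supE t : `|t| <= 1 -> ((Normc.normc ((line_poly lam p).[t] / (line_poly lam q).[t]))%:E
    <= rat_supnorm p q K)%E.
  move=> t1; apply: ereal_sup_ubound; exists (\row_i (lam i * t)); first exact: discK.
  by rewrite !horner_line_poly.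
have Q_neq0 t : `|t| <= 1 -> (line_poly lam q).[t] != 0.
  by move=> /discK /q_off; rewrite horner_line_poly.
rewrite /rat_tuple !poly_tuple_line.
move: (line_poly lam p) (line_poly lam q) supE Q_neq0 => P Q supE Q_neq0.
case: (rat_supnorm p q K) supE => [M||] supE; last 1 first.
- by have := supE 0; rewrite normr0 ler01 => /(_ isT).
- rewrite lee_fin.
  have M_ge0 : 0 <= M.
    have := supE 0; rewrite normr0 ler01 lee_fin => /(_ isT); apply: le_trans.
    by rewrite -lecR -normC_normc rmorph0 normr_ge0.
  (* B is chosen so that M * B <= M + e; the denominator 1 + M is positive
     even if M = 0. *)
  apply/ler_addgt0Pr => e e_gt0; pose B := 1 + e / (1 + M).
  have M1_gt0 : 0 < 1 + M by rewrite ltr_wpDr.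
  have B_gt1 : 1 < B by rewrite ltrDl divr_gt0.
  apply: (@le_trans _ _ (M * B)); last first.
    rewrite mulrDr mulr1 lerD2l mulrCA ler_piMr ?(ltW e_gt0) //.
    by rewrite ler_pdivrMr // mul1r lerDr.
  have [H [E [QH QHB]]] := poly_inverse_mod_X2 Q_neq0 B_gt1.
  have NQH : horner_mx N Q *m horner_mx N H = 1%:M.
    rewrite mulmxE -rmorphM QH /= (horner_mx_sqr0 _ jordan_block_sqr0).
    by rewrite !coefD !coefXnM !coef1 /= !addr0 scale0r addr0.
  have [Qu _] := mulmx1_unit NQH.
  rewrite -[invmx _]mulmx1 -NQH (mulKmx Qu) mulmxE -rmorphM.
  apply: von_neumann_jordan_block => [|t t1].
    by rewrite mulr_ge0 // (le_trans _ (ltW B_gt1)).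
  have t_le1 : `|t| <= 1 by rewrite t1.
  have -> : (P * H).[t] = P.[t] / Q.[t] * (Q * H).[t].
    by rewrite !hornerM mulrA divfK ?Q_neq0.
  rewrite normrM rmorphM ler_pM ?QHB // normC_normc lecR -lee_fin.
  exact: supE.
- by rewrite leey.
Qed.

End DiscInSpectralSet.

(** * Fundamental operators when the defect operator is invertible *)

Definition compressed (K : comUnitRingType) n (D X : 'M[K]_n) :=
  invmx D *m X *m invmx D.

(** Cancelling the outer factors D^-1 leaves only (D^-1)^2, so that D matters
    through D *m D alone. *)
Lemma compressed_commute (K : comUnitRingType) n (D X Y : 'M[K]_n) :
  D \in unitmx ->
  compressed D X *m compressed D Y = compressed D Y *m compressed D X ->
  X *m invmx (D *m D) *m Y = Y *m invmx (D *m D) *m X.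
Proof.
move=> D_unit; have invDD : invmx (D *m D) = invmx D *m invmx D.
  apply: (can_inj (mulKmx D_unit)); apply: (can_inj (mulKmx D_unit)).
  by rewrite mulKVmx // mulmxV // mulmxA mulmxV // unitmx_mul D_unit.
have cE Z W : compressed D Z *m compressed D W =
    invmx D *m (Z *m invmx (D *m D) *m W) *m invmx D.
  by rewrite invDD /compressed !mulmxA.
rewrite !cE => /(can_inj (mulmxKV D_unit)).
exact: (can_inj (mulKVmx D_unit)).
Qed.

Lemma mulmx_cV_inj (K : pzRingType) m n (A B : 'M[K]_(m, n)) :
  (forall v : 'cV_n, A *m v = B *m v) -> A = B.
Proof.
move=> eqAB; apply/matrixP => i j.
by have /colP/(_ i) := eqAB (delta_mx j 0); rewrite -!colE [LHS]mxE [RHS]mxE.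
Qed.

Section FundamentalOperators.
Variable R : realType.
Local Notation C := R[i].
Local Open Scope sesquilinear_scope.

Lemma psd_diag n (d : 'rV[C]_n) : (forall i, 0 <= d 0 i) -> psd (diag_mx d).
Proof.
move=> d_ge0 x; rewrite mxE sumr_ge0 // => i _.
rewrite mul_mx_diag !mxE mulrAC mulr_ge0 // [X in 0 <= X]mulrC -normCK.
by rewrite exprn_ge0.
Qed.

(** Some positive square root exists, namely the entrywise one, so the chosen
    value is a genuine square root of diag_mx d. *)
Lemma psd_sqrt_diag_sqr n (d : 'rV[C]_n) : (forall i, 0 <= d 0 i) ->
  psd_sqrt (diag_mx d) *m psd_sqrt (diag_mx d) = diag_mx d.
Proof.
move=> d_ge0; suff [] : psd (psd_sqrt (diag_mx d)) /\
  psd_sqrt (diag_mx d) *m psd_sqrt (diag_mx d) = diag_mx d by [].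
apply: (@xgetPex _ 0 [set S | psd S /\ S *m S = diag_mx d]).
exists (diag_mx (map_mx sqrtC d)); split.
  by apply: psd_diag => i; rewrite mxE sqrtC_ge0.
rewrite mulmx_diag; congr diag_mx; apply/rowP => i.
by rewrite !mxE -expr2 sqrtCK.
Qed.

Section InvertibleDefect.
Variables (n : nat) (T : 'I_3 -> 'M[C]_n.+1).
Local Notation D := (defect (T 2)).
Local Notation V := (defect_space (T 2)).
Hypothesis D_unit : D \in unitmx.

Lemma mem_defect_space v : v \in V.
Proof.
rewrite -(mulKVmx D_unit v) -[D *m _](lfunE (mulmx D)).
exact: memv_img (memvf _).
Qed.

Definition fundamental_op (X : 'M[C]_n.+1) : 'End(subvs_of V) :=
  linfun (vsproj V \o (mulmx (compressed D X) \o vsval)).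

Lemma fundamental_opE X w :
  vsval (fundamental_op X w) = compressed D X *m vsval w.
Proof. by rewrite lfunE /= vsprojK // mem_defect_space. Qed.

Lemma fundamental_op_factors X h :
  X *m h = D *m vsval (fundamental_op X (vsproj V (D *m h))).
Proof.
rewrite fundamental_opE vsprojK ?mem_defect_space // /compressed.
by rewrite -!mulmxA (mulKVmx D_unit) (mulKmx D_unit).
Qed.

Lemma fundamental_op_unique X (G : 'End(subvs_of V)) :
  (forall h, X *m h = D *m vsval (G (vsproj V (D *m h)))) ->
  G = fundamental_op X.
Proof.
move=> GX; apply/lfunP => w; apply: val_inj; rewrite /= fundamental_opE.
have := GX (invmx D *m vsval w); rewrite (mulKVmx D_unit) vsvalK => XG.
by rewrite -(mulKmx D_unit (vsval (G w))) -XG /compressed -!mulmxA.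
Qed.

Lemma fundamental_op_commute X Y :
  (fundamental_op X \o fundamental_op Y)%VF =
  (fundamental_op Y \o fundamental_op X)%VF ->
  X *m invmx (D *m D) *m Y = Y *m invmx (D *m D) *m X.
Proof.
move=> FXY; have cXY : compressed D X *m compressed D Y = compressed D Y *m compressed D X.
  have FE Z W h : vsval ((fundamental_op Z \o fundamental_op W)%VF (vsproj V h)) =
      compressed D Z *m compressed D W *m h.
    have compE (F G : 'End(subvs_of V)) w : (F \o G)%VF w = F (G w).
      exact: comp_lfunE.
    rewrite compE.
    rewrite fundamental_opE.
    rewrite fundamental_opE.
    rewrite -mulmxA.
    congr (_ *m (_ *m _)).
    by rewrite vsprojK ?mem_defect_space.
  by apply: mulmx_cV_inj => h; rewrite -FE FXY FE.
exact: compressed_commute D_unit cXY.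
Qed.

End InvertibleDefect.

(** * The defect operator of a multiple of the Jordan block *)

Local Notation N := (delta_mx 0 1 : 'M[C]_2).

Lemma adjoint_jordan_mul (a b : C) :
  (a *: N)^t* *m (b *: N) = (Num.conj a * b) *: delta_mx 1 1.
Proof.
rewrite -scalemxAr linearZ /= map_mxZ -scalemxAl scalerA mulrC; congr (_ *: _).
by rewrite trmx_delta map_delta_mx mul_delta_mx.
Qed.

Definition defect_diag (a : C) : 'rV[C]_2 :=
  \row_i (if i == 0 then 1 else 1 - `|a| ^+ 2).

Lemma defect_sqr_jordan_block (a : C) : `|a| < 1 ->
  defect (a *: N) *m defect (a *: N) = diag_mx (defect_diag a).
Proof.
move=> a_lt1; rewrite /defect adjoint_jordan_mul.
have -> : 1%:M - (Num.conj a * a) *: delta_mx 1 1 = diag_mx (defect_diag a).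
  rewrite [_ * a]mulrC -normCK; apply/matrixP => i j; rewrite !mxE.
  by case: i j => [[|[|//]] ?] [[|[|//]] ?] /=;
    rewrite ?mulr0 ?mulr1 ?subr0 ?mulr1n ?mulr0n.
apply: psd_sqrt_diag_sqr => i; rewrite mxE; case: ifP => // _.
by rewrite subr_ge0 expr_le1 // ltW.
Qed.

Lemma defect_diag_mulV (a : C) : `|a| < 1 ->
  diag_mx (defect_diag a) *m diag_mx (map_mx GRing.inv (defect_diag a)) = 1%:M.
Proof.
move=> a_lt1; rewrite mulmx_diag -diag_const_mx; congr diag_mx; apply/rowP => i.
rewrite !mxE divff //; case: ifP => _; first exact: oner_neq0.
by apply: lt0r_neq0; rewrite subr_gt0 expr_lt1.
Qed.

Lemma defect_jordan_block_unit (a : C) : `|a| < 1 ->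
  defect (a *: N) \in unitmx.
Proof.
move=> a_lt1; have [A_unit _] := mulmx1_unit (defect_diag_mulV a_lt1).
by move: A_unit; rewrite -defect_sqr_jordan_block // unitmx_mul andbb.
Qed.

Lemma invmx_defect_sqr (a : C) : `|a| < 1 ->
  invmx (defect (a *: N) *m defect (a *: N)) =
  diag_mx (map_mx GRing.inv (defect_diag a)).
Proof.
move=> a_lt1; rewrite defect_sqr_jordan_block //.
have DV := defect_diag_mulV a_lt1; have [A_unit _] := mulmx1_unit DV.
by rewrite -[RHS](mulKmx A_unit) DV mulmx1.
Qed.

(** Exchanging the two outer factors exchanges l0 and l1, hence the entry
    distinguishes their orders as soon as the norms of l0 and l1 differ. *)
Lemma commuting_fundamental_entry (l0 l1 l2 : C) (d : 'rV[C]_2) :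
  ((l0 *: N - (Num.conj l1 * l2) *: delta_mx 1 1) *m diag_mx d
     *m (l1 *: N - (Num.conj l0 * l2) *: delta_mx 1 1)) 0 1
  = - (`|l0| ^+ 2 * l2 * d 0 1).
Proof.
rewrite normCK mul_mx_diag mxE !big_ord_recl big_ord0 !mxE /=.
rewrite !mulr0 !mulr1 !subr0 !mul0r add0r addr0.
have -> : lift ord0 ord0 = 1 :> 'I_2 by apply: val_inj.
by rewrite /= ; ring.
Qed.

End FundamentalOperators.

(** * Non-commuting fundamental operators *)

Theorem theorem2p3 (R : realType) (r : R) (lam : 'I_3 -> R[i])
  (r01 : 0 < r < 1)
  (hr : [set r%:C *: z | z in closed_polydisc R] `<=` tetrablock R)
  (hlam : forall j, 0 < `|lam j| < r%:C)
  (hne : `|lam 0| != `|lam 1|) :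
  let T := fun j : 'I_3 => lam j *: delta_mx 0 1 : 'M[R[i]]_2 in
  tetrablock_contraction T /\
  exists F1 F2 : 'End(subvs_of (defect_space (T 2))),
    [/\ fundamental_operators T F1 F2,
        forall G1 G2 : 'End(subvs_of (defect_space (T 2))),
          fundamental_operators T G1 G2 -> G1 = F1 /\ G2 = F2
      & (F1 \o F2)%VF <> (F2 \o F1)%VF].
Proof.
have [r_gt0 r_lt1] := andP r01; move=> T; split.
  split=> [i j|].
    by rewrite /T -!scalemxAl -!scalemxAr jordan_block_sqr0 !scaler0.
  apply: spectral_set_jordan_block => t t_le1.
  suff: tetrablock R (\row_i (lam i * t)).
    by case=> A /= A_lt1 <-; exists A => //=; apply: ltW.
  (* t lam = r (t lam / r), and |lam_i| < r. *)
  apply: hr; exists (\row_i (lam i * t / r%:C)) => [i|]; last first.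
    by apply/rowP => i; rewrite !mxE mulrC divfK // fmorph_eq0 gt_eqF.
  rewrite mxE !normrM normfV [`|r%:C|]ger0_norm ?lecR ?(ltW r_gt0) //.
  rewrite ler_pdivrMr ?ltcR // mul1r.
  have [_ /ltW lam_le] := andP (hlam i).
  by apply: le_trans lam_le; rewrite ler_piMr.
have lam2_lt1 : `|lam 2| < 1.
  by have [_ lam_lt] := andP (hlam 2); apply: lt_trans lam_lt _; rewrite ltcR.
have D_unit : defect (T 2) \in unitmx by apply: defect_jordan_block_unit.
pose X := T 0 - map_mx Num.conj (T 1)^T *m T 2.
pose Y := T 1 - map_mx Num.conj (T 0)^T *m T 2.
exists (fundamental_op T X), (fundamental_op T Y); split.
- by split=> h; apply: fundamental_op_factors.
- move=> G1 G2 [G1X G2Y].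
  by split; apply: fundamental_op_unique.
move=> /(fundamental_op_commute D_unit).
rewrite (invmx_defect_sqr lam2_lt1).
have -> : X = lam 0 *: delta_mx 0 1 - (Num.conj (lam 1) * lam 2) *: delta_mx 1 1.
  by rewrite /X adjoint_jordan_mul.
have -> : Y = lam 1 *: delta_mx 0 1 - (Num.conj (lam 0) * lam 2) *: delta_mx 1 1.
  by rewrite /Y adjoint_jordan_mul.
move=> /matrixP/(_ 0 1); rewrite !commuting_fundamental_entry => /oppr_inj.
have l2_neq0 : lam 2 != 0 by rewrite -normr_gt0; have [] := andP (hlam 2).
have d_neq0 : 1 - `|lam 2| ^+ 2 != 0 by apply: lt0r_neq0; rewrite subr_gt0 expr_lt1.
rewrite !mxE /= => /(mulIf (invr_neq0 d_neq0))/(mulIf l2_neq0)/eqP.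
by rewrite eqrXn2 ?normr_ge0 // (negPf hne).
Qed.
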